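(* Let $S,\mathcal Z,h^{\mathcal Z},R,g_R$ be as in the context. Let $U\subset S$ be open, let $(N,h^N)$ be a Riemannian manifold, let $\Theta:U\to N$ be a smooth map, and suppose there is a vector-bundle isomorphism $\Psi:\mathcal Z|_U\to\Theta^*TN$ with $\Psi\circ R=d\Theta$. Suppose that $(g_R)_p$ is positive definite at some $p\in U$. Then there exists a neighbourhood $U_0\subset U$ of $p$ on which $\Theta$ is a smooth embedding. In particular, the members $g_q$, $q\in U_0$, of the parameterized family are uniquely determined by their observation data: if $q_1,q_2\in U_0$ and $\Theta(q_1)=\Theta(q_2)$, then $q_1=q_2$.
   Context: $S$ is a smooth finite-dimensional manifold parameterizing a smooth family $\{g_p\}_{p\in S}$ of normalized Einstein metrics on a fixed smooth manifold $M$. The family comes with the following given data: a smooth real vector bundle $\mathcal Z\to S$ of finite rank (the observation bundle), a smooth positive-definite fibre metric $h^{\mathcal Z}$ on $\mathcal Z$, and a smooth vector bundle morphism $R:TS\to\mathcal Z$ over the identity of $S$, with fibre maps $R_p:T_pS\to\mathcal Z_p$. The response metric is $g_R=R^*h^{\mathcal Z}$, i.e. $(g_R)_p(X,Y)=h^{\mathcal Z}_p(R_pX,R_pY)$. All manifolds, bundles and bundle maps are smooth. No compatibility between $h^{\mathcal Z}$ and $h^N$ is assumed. *)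

(* Defs.v *)
From HB Require Import structures.
From mathcomp Require Import all_boot all_order all_algebra.
From mathcomp Require Import all_classical all_reals all_analysis.
Set Implicit Arguments.
Unset Strict Implicit.
Unset Printing Implicit Defensive.
Import Order.TTheory GRing.Theory Num.Theory.
Import numFieldNormedType.Exports.
Local Open Scope classical_set_scope.
Local Open Scope ring_scope.

(* Smoothness of maps between finite-dimensional normed spaces on an open set.
   In finite dimension the derivative x |-> 'd f x is C^k if and only if
   x |-> 'd f x v is C^k for every fixed v. *)
Fixpoint Ck_on (R : realType) (V W : normedModType R) (k : nat) (A : set V)
    (f : V -> W) : Prop :=
  match k with
  | 0 => forall x, A x -> {for x, continuous f}
  | k'.+1 => (forall x, A x -> differentiable f x) /\
             (forall v, Ck_on k' A (fun x => 'd f x v))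
  end.

Definition Cinf_on (R : realType) (V W : normedModType R) (A : set V)
    (f : V -> W) : Prop := forall k, Ck_on k A f.

Section SmoothTheory.
Context {R : realType}.
Implicit Types V W X : normedModType R.

Lemma near_eq_diff V W (f g : V -> W) (x : V) :
  (\forall y \near x, f y = g y) -> differentiable f x ->
  differentiable g x /\ forall v, 'd g x v = 'd f x v.
Proof.
move=> fg df; pose z : V -> W := fun y => g y - f y.
have zx : z x = 0 by rewrite /z (nbhs_singleton fg) subrr.
have z0 : continuous (\0 : V -> W) /\ z \o shift x = cst (z x) + (\0 : V -> W) +o_ 0 id.
  split; first exact: cst_continuous.
  apply/eqaddoP => _/posnumP[e]; rewrite zx.
  have fg' : \forall y \near x, z y = 0.
    by apply: filterS fg => y e'; rewrite /z e' subrr.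
  move: fg'; rewrite (near_shift 0 x) => fg'.
  apply: filterS fg' => y /=; rewrite subr0 => zy.
  rewrite [X in `|X|](_ : _ = 0) ?normr0 ?mulr_ge0 //.
  by rewrite -[LHS]/(z (y + x) - (0 + 0)) zy addr0 subrr.
have dz0 : 'd z x = (\0 : V -> W) :> (V -> W) by have [? ?] := z0; apply: diff_unique.
have dz : differentiable z x by apply/diff_locallyP; rewrite dz0.
have -> : g = f + z by apply/funext => y; rewrite fctE /z addrC subrK.
split; first exact: differentiableD.
move=> v; have d0 : 'd z x v = 0 := congr1 (fun h => h v) dz0.
have -> : 'd (f + z) x v = 'd f x v + 'd z x v.
  by rewrite diffD.
by rewrite d0 addr0.
Qed.

Lemma Ck_on_ext V W k (A : set V) (f g : V -> W) : open A ->
  (forall x, A x -> f x = g x) -> Ck_on k A f -> Ck_on k A g.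
Proof.
move=> oA; have nA x : A x -> nbhs x A by move=> Ax; apply: open_nbhs_nbhs.
elim: k f g => [|k IH] f g fg /=.
  move=> cf x Ax; apply: cvg_trans (_ : f @ x --> g x).
    by apply: near_eq_cvg; apply: filterS (nA x Ax) => y /fg.
  by rewrite -fg //; exact: cf.
have key x : A x -> differentiable f x ->
    differentiable g x /\ forall v, 'd g x v = 'd f x v.
  by move=> Ax; apply: near_eq_diff; apply: filterS (nA x Ax) => y /fg.
move=> [df Cf]; split=> [x Ax|v]; first by have [] := key x Ax (df x Ax).
by apply: IH (Cf v) => x Ax; have [_ e] := key x Ax (df x Ax); rewrite -e.
Qed.

Lemma Ck_on_sub V W k (A B : set V) (f : V -> W) :
  A `<=` B -> Ck_on k B f -> Ck_on k A f.
Proof.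
move=> AB; elim: k f => [|k IH] f /=; first by move=> cf x /AB/cf.
by move=> [df Cf]; split=> [x /AB/df//|v]; exact: IH.
Qed.

Lemma Ck_onS V W k (A : set V) (f : V -> W) : Ck_on k.+1 A f -> Ck_on k A f.
Proof.
elim: k f => [|k IH] f [df Cf] /=.
  by move=> x /df; exact: differentiable_continuous.
by split=> // v; exact: IH.
Qed.

Lemma Ck_on_linear V W X k (A : set V) (f : V -> W) (L : {linear W -> X}) :
  open A -> continuous L -> Ck_on k A f -> Ck_on k A (fun x => L (f x)).
Proof.
move=> oA cL; elim: k f => [|k IH] f /=.
  by move=> cf x Ax; apply: continuous_comp; [exact: cf|exact: cL].
move=> [df Cf]; split=> [x Ax|v].
  by apply: (differentiable_comp (df x Ax)); exact: linear_differentiable.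
apply: Ck_on_ext (IH _ (Cf v)) => // x Ax.
have dL : differentiable L (f x) by exact: linear_differentiable.
by rewrite -[fun x => L (f x)]/(L \o f) (diff_comp (df x Ax) dL) /= diff_lin.
Qed.

Lemma Ck_on_cst V W k (A : set V) (w : W) : Ck_on k A (fun=> w).
Proof.
elim: k w => [|k IH] w /=; first by move=> x _; exact: cst_continuous.
split=> [x _|v]; first exact: differentiable_cst.
rewrite [X in Ck_on _ _ X](_ : _ = fun=> 0) //.
by apply/funext => x; rewrite -[fun=> w]/(cst w) diff_cst.
Qed.

Lemma Ck_onD V W k (A : set V) (f g : V -> W) : open A ->
  Ck_on k A f -> Ck_on k A g -> Ck_on k A (fun x => f x + g x).
Proof.
move=> oA; elim: k f g => [|k IH] f g /=.
  by move=> cf cg x Ax; apply: cvgD; [exact: cf|exact: cg].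
move=> [df Cf] [dg Cg]; split=> [x Ax|v].
  by apply: differentiableD; [exact: df|exact: dg].
apply: Ck_on_ext (IH _ _ (Cf v) (Cg v)) => // x Ax.
by rewrite -[fun x => _ + _]/(f + g) diffD //; [exact: df|exact: dg].
Qed.

Lemma Ck_on_sum V W k (A : set V) (I : Type) (r : seq I) (f : I -> V -> W) :
  open A -> (forall i, Ck_on k A (f i)) ->
  Ck_on k A (fun x => \sum_(i <- r) f i x).
Proof.
move=> oA Cf; elim: r => [|i r IH].
  by apply: Ck_on_ext (@Ck_on_cst _ _ k A 0) => // x _; rewrite big_nil.
apply: Ck_on_ext (Ck_onD oA (Cf i) IH) => // x _; by rewrite big_cons.
Qed.

Lemma Ck_onM V k (A : set V) (f g : V -> R) : open A ->
  Ck_on k A f -> Ck_on k A g -> Ck_on k A (fun x => f x * g x).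
Proof.
move=> oA; elim: k f g => [|k IH] f g.
  by move=> cf cg x Ax; apply: cvgM; [exact: cf|exact: cg].
move=> Cf1 Cg1; have Cf0 := Ck_onS Cf1; have Cg0 := Ck_onS Cg1.
case: Cf1 => df Cf; case: Cg1 => dg Cg; split=> [x Ax|v].
  by apply: differentiableM; [exact: df|exact: dg].
apply: Ck_on_ext (Ck_onD oA (IH _ _ Cf0 (Cg v)) (IH _ _ Cg0 (Cf v))) => // x Ax.
by rewrite -[fun x => _ * _]/(f * g) diffM //; [exact: df|exact: dg].
Qed.

Lemma Ck_on_coord V m n k (A : set V) (f : V -> 'M[R]_(m, n)) i j :
  open A -> Ck_on k A f -> Ck_on k A (fun x => f x i j).
Proof.
move=> oA Cf.
have lc : linear (fun N : 'M[R]_(m, n) => N i j : R) by move=> a u v; rewrite !mxE.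
pose cM := GRing.isLinear.Build _ _ _ _ _ lc.
pose cL : {linear 'M[R]_(m, n) -> R} := HB.pack (fun N : 'M[R]_(m, n) => N i j : R) cM.
by apply: (Ck_on_linear (L := cL)) => //; exact: coord_continuous.
Qed.

Lemma Ck_on_mx V m n k (A : set V) (f : V -> 'M[R]_(m, n)) : open A ->
  (forall i j, Ck_on k A (fun x => f x i j)) -> Ck_on k A f.
Proof.
move=> oA Cf.
apply: (@Ck_on_ext _ _ k A
  (fun x => \sum_(i <- enum 'I_m) \sum_(j <- enum 'I_n) f x i j *: delta_mx i j)) => //.
  move=> x _; rewrite [RHS]matrix_sum_delta big_enum /=; apply: eq_bigr => i _.
  by rewrite big_enum.
apply: Ck_on_sum => // i; apply: Ck_on_sum => // j.
have lc : linear ( *:%R ^~ (delta_mx i j) : R -> 'M[R]_(m, n)).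
  by move=> a u v; rewrite scalerDl scalerA.
pose cM := GRing.isLinear.Build _ _ _ _ _ lc.
pose cL : {linear R -> 'M[R]_(m, n)} := HB.pack ( *:%R ^~ (delta_mx i j)) cM.
by apply: (Ck_on_linear (L := cL)) => //; exact: scalel_continuous.
Qed.

Lemma Ck_on_comp V m a b k (A : set V) (B : set 'rV[R]_m) (f : V -> 'rV[R]_m)
    (g : 'rV[R]_m -> 'M[R]_(a, b)) : open A -> (forall x, A x -> B (f x)) ->
  Ck_on k A f -> Ck_on k B g -> Ck_on k A (g \o f).
Proof.
move=> oA AB; elim: k g => [|k IH] g.
  move=> cf cg x Ax; apply: continuous_comp; first exact: cf.
  exact/cg/AB.
move=> Cf1; have Cf0 := Ck_onS Cf1; case: Cf1 => df Cf [dg Cg]; split=> [x Ax|v].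
  by apply: differentiable_comp; [exact: df|exact/dg/AB].
apply: (@Ck_on_ext _ _ k A (fun x =>
   \sum_(i <- enum 'I_m) ('d f x v) 0 i *: 'd g (f x) (delta_mx 0 i))) => //.
  move=> x Ax; rewrite (diff_comp (df x Ax) (dg _ (AB x Ax))) /=.
  rewrite [in RHS](row_sum_delta ('d f x v)) linear_sum big_enum /=.
  by apply: eq_bigr => i _; rewrite linearZ.
apply: Ck_on_sum => // i; apply: Ck_on_mx => // p q.
apply: (@Ck_on_ext _ _ k A (fun x => ('d f x v) 0 i * ('d g (f x) (delta_mx 0 i)) p q)) => //.
  by move=> x _; rewrite mxE.
apply: Ck_onM => //; first by apply: Ck_on_coord => //; exact: Cf.
by apply: Ck_on_coord => //; exact: (IH (fun y => 'd g y (delta_mx 0 i)) Cf0 (Cg _)).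
Qed.

Lemma diff_compE V W X (f : V -> W) (g : W -> X) x y v : f x = y ->
  differentiable f x -> differentiable g y ->
  'd (g \o f) x v = 'd g y ('d f x v).
Proof. by move=> <- df dg; rewrite diff_comp. Qed.

Lemma diff_idE V (x : V) :
  differentiable (id : V -> V) x /\ forall v, 'd (id : V -> V) x v = v.
Proof. by split=> [|v]; [exact: ex_diff|rewrite diff_val]. Qed.

End SmoothTheory.

(* [cinv] is only meaningful on the image [cmap @` cdom]. *)
Record chart (R : realType) (T : topologicalType) (n : nat) := Chart {
  cdom : set T;
  cmap : T -> 'rV[R]_n;
  cinv : 'rV[R]_n -> T;
  cdom_open : open cdom;
  cimg_open : open (cmap @` cdom);
  cmapK : forall p, cdom p -> cinv (cmap p) = p;
  cmap_cont : forall p, cdom p -> {for p, continuous cmap};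
  cinv_cont : forall p, cdom p -> {for cmap p, continuous cinv} }.

(* A smooth manifold of dimension [n], given by a not necessarily maximal
   atlas; no notion below depends on the choice of an atlas of a given smooth
   structure. *)
Record manifold (R : realType) (n : nat) := Manifold {
  carrier :> topologicalType;
  manifold_hausdorff : hausdorff_space carrier;
  manifold_second_countable : @second_countable carrier;
  atlas : set (chart R carrier n);
  atlas_cover : forall p, exists c, atlas c /\ cdom c p;
  atlas_compat : forall c d, atlas c -> atlas d ->
    Cinf_on (cmap c @` (cdom c `&` cdom d)) (cmap d \o cinv c) }.

Section Manifolds.
Context {R : realType}.

Definition smooth_fun_on (n : nat) (M : manifold R n) (W : normedModType R)
    (U : set M) (f : M -> W) : Prop :=
  forall c, atlas c -> Cinf_on (cmap c @` (cdom c `&` U)) (f \o cinv c).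

Definition smooth_map_on (m n : nat) (M : manifold R m) (N : manifold R n)
    (U : set M) (f : M -> N) : Prop :=
  (forall p, U p -> {for p, continuous f}) /\
  (forall c d, atlas c -> atlas d ->
    Cinf_on (cmap c @` (cdom c `&` U `&` f @^-1` cdom d))
            (cmap d \o f \o cinv c)).

(* Vector bundles are given by their fibres, which are vector spaces, and a
   family of local trivializations with smooth transition functions; this data
   determines the smooth structure of the total space. *)
Record local_triv (n : nat) (M : manifold R n) (E : M -> lmodType R)
    (k : nat) := LocalTriv {
  tdom : set M;
  tmap : forall p, {linear E p -> 'rV[R]_k};
  tinv : forall p, 'rV[R]_k -> E p }.

Record prebundle (n : nat) (M : manifold R n) (k : nat) := PreBundle {
  fibre :> M -> lmodType R;
  trivs : set (local_triv fibre k) }.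

Definition transition (n : nat) (M : manifold R n) (k : nat)
    (E : prebundle M k) (t s : local_triv E k) (p : M) : 'M[R]_k :=
  \matrix_i tmap s p (tinv t p (delta_mx 0 i)).

Record is_vbundle (n : nat) (M : manifold R n) (k : nat)
    (E : prebundle M k) : Prop := IsVBundle {
  triv_open : forall t : local_triv E k, trivs t -> open (tdom t);
  triv_cover : forall p, exists2 t : local_triv E k, trivs t & tdom t p;
  tmapK : forall t : local_triv E k, trivs t ->
    forall p, tdom t p -> cancel (tmap t p) (tinv t p);
  tinvK : forall t : local_triv E k, trivs t ->
    forall p, tdom t p -> cancel (tinv t p) (tmap t p);
  triv_smooth : forall t s : local_triv E k, trivs t -> trivs s ->
    smooth_fun_on (tdom t `&` tdom s) (transition t s) }.

Record vbundle (n : nat) (M : manifold R n) (k : nat) := VBundle {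
  vbundle_pre :> prebundle M k;
  vbundle_axioms : is_vbundle vbundle_pre }.

(* The pullback of [E] along [f]; when [f] is smooth on an open set [U], its
   restriction to [U] is a vector bundle over [U]. *)
Definition pullback (m n : nat) (M : manifold R m) (N : manifold R n) (k : nat)
    (f : M -> N) (E : prebundle N k) : prebundle M k :=
  @PreBundle _ M k (fun p => E (f p))
    [set u | exists2 t : local_triv E k, trivs t &
       u = LocalTriv (f @^-1` tdom t) (fun p => tmap t (f p))
                     (fun p => tinv t (f p))].

(* Bundle morphisms E|_U -> F|_U over the identity of [U]; values outside [U]
   are irrelevant. *)
Record bundle_hom_on (n : nat) (M : manifold R n) (k l : nat) (U : set M)
    (E : prebundle M k) (F : prebundle M l) := BundleHom {
  hom_fun :> forall p, {linear E p -> F p};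
  hom_smooth : forall (t : local_triv E k) (s : local_triv F l),
    trivs t -> trivs s ->
    smooth_fun_on (U `&` tdom t `&` tdom s)
      (fun p => \matrix_i tmap s p (hom_fun p (tinv t p (delta_mx 0 i)))
                : 'M[R]_(k, l)) }.

Definition bundle_iso_on (n : nat) (M : manifold R n) (k l : nat) (U : set M)
    (E : prebundle M k) (F : prebundle M l) (A : bundle_hom_on U E F) : Prop :=
  exists B : bundle_hom_on U F E,
    forall p, U p -> cancel (A p) (B p) /\ cancel (B p) (A p).

Definition gram (n : nat) (M : manifold R n) (k : nat) (E : prebundle M k)
    (h : forall p, E p -> E p -> R) (t : local_triv E k) (p : M) : 'M[R]_k :=
  \matrix_(i, j) h p (tinv t p (delta_mx 0 i)) (tinv t p (delta_mx 0 j)).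

Definition posdef (V : lmodType R) (b : V -> V -> R) : Prop :=
  forall u, u != 0 -> 0 < b u u.

Record fibre_metric (n : nat) (M : manifold R n) (k : nat)
    (E : prebundle M k) := FibreMetric {
  metric_fun :> forall p, E p -> E p -> R;
  metric_sym : forall p u v, @metric_fun p u v = @metric_fun p v u;
  metric_lin : forall p a u v w,
    @metric_fun p (a *: u + v) w = a * @metric_fun p u w + @metric_fun p v w;
  metric_pos : forall p, posdef (@metric_fun p);
  metric_smooth : forall t : local_triv E k, trivs t ->
    smooth_fun_on (tdom t) (gram (@metric_fun) t) }.

Section Tangent.
Context {n : nat} (M : manifold R n).

Definition chart_at (p : M) : chart R M n := sval (cid (atlas_cover p)).

(* The tangent space at [p] is R^n, its elements being the coordinate vectors
   of tangent vectors in the chart [chart_at p]; a chart [c] at [p] reads the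
   tangent vector v as D(c o (chart_at p)^-1) v. *)
Definition tangent_triv (c : chart R M n) :
    local_triv (fun _ : M => 'rV[R]_n : lmodType R) n :=
  @LocalTriv _ M _ n (cdom c)
    (fun p => 'd (cmap c \o cinv (chart_at p)) (cmap (chart_at p) p))
    (fun p => 'd (cmap (chart_at p) \o cinv c) (cmap c p)).

Definition tangent_pre : prebundle M n :=
  @PreBundle _ M n _ [set tangent_triv c | c in [set c | atlas c]].

Lemma chart_atP p : atlas (chart_at p) /\ cdom (chart_at p) p.
Proof. by rewrite /chart_at; case: cid. Qed.

Lemma cdomI_open (c : chart R M n) (U : set M) : open U ->
  open (cmap c @` (cdom c `&` U)).
Proof.
move=> oU; rewrite openE => _ [p [cp Up] <-] /=.
have nU : nbhs (cmap c p) (cinv c @^-1` U).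
  by apply: (cinv_cont cp); rewrite cmapK //; exact: open_nbhs_nbhs.
have nI : nbhs (cmap c p) (cmap c @` cdom c).
  by apply: open_nbhs_nbhs; split; [exact: cimg_open|exists p].
apply: filterS (filterI nU nI) => x [/= Ux [q cq qx]].
by exists q => //; split=> //; rewrite -(cmapK cq) qx.
Qed.

Lemma trans_near (c d e : chart R M n) p : cdom c p -> cdom d p ->
  \forall x \near cmap c p,
    ((cmap e \o cinv d) \o (cmap d \o cinv c)) x = (cmap e \o cinv c) x.
Proof.
move=> cp dp; have o := cdomI_open (c := c) (cdom_open d).
have : nbhs (cmap c p) (cmap c @` (cdom c `&` cdom d)).
  by apply: open_nbhs_nbhs; split => //; exists p.
by apply: filterS => _ [q [cq dq] <-] /=; rewrite cmapK // cmapK.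
Qed.

Lemma trans_differentiable (c d : chart R M n) p : atlas c -> atlas d ->
  cdom c p -> cdom d p -> differentiable (cmap d \o cinv c) (cmap c p).
Proof.
by move=> ac ad cp dp; have [+ _] := atlas_compat ac ad 1; apply; exists p.
Qed.

Lemma trans_diff (c d e : chart R M n) p v :
  atlas c -> atlas d -> atlas e -> cdom c p -> cdom d p -> cdom e p ->
  'd (cmap e \o cinv d) (cmap d p) ('d (cmap d \o cinv c) (cmap c p) v) =
  'd (cmap e \o cinv c) (cmap c p) v.
Proof.
move=> ac ad ae cp dp ep.
have dcd := trans_differentiable ac ad cp dp.
have dde := trans_differentiable ad ae dp ep.
have fx : (cmap d \o cinv c) (cmap c p) = cmap d p by rewrite /= cmapK.
have dde' : differentiable (cmap e \o cinv d) ((cmap d \o cinv c) (cmap c p)).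
  by rewrite fx.
have [_ E] := near_eq_diff (trans_near e cp dp) (differentiable_comp dcd dde').
exact: esym (etrans (E v) (diff_compE v fx dcd dde)).
Qed.

Lemma trans_diff_id (c : chart R M n) p v : cdom c p ->
  'd (cmap c \o cinv c) (cmap c p) v = v.
Proof.
move=> cp; have idn : \forall x \near cmap c p, id x = (cmap c \o cinv c) x.
  have : nbhs (cmap c p) (cmap c @` cdom c).
    by apply: open_nbhs_nbhs; split; [exact: cimg_open|exists p].
  by apply: filterS => _ [q cq <-] /=; rewrite cmapK.
have [did idE] := diff_idE (cmap c p).
by have [_ E] := near_eq_diff idn did; exact: etrans (E v) (idE v).
Qed.

Lemma tangent_transition (c d : chart R M n) p i j : atlas c -> atlas d ->
  cdom c p -> cdom d p ->
  @transition _ M n tangent_pre (tangent_triv c) (tangent_triv d) p i j =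
  'd (cmap d \o cinv c) (cmap c p) (delta_mx 0 i) 0 j.
Proof.
move=> ac ad cp dp; have [ap pp] := chart_atP p; rewrite mxE.
exact: (congr1 (fun w : 'rV[R]_n => w 0 j)
  (trans_diff (delta_mx 0 i) ac ap ad cp pp dp)).
Qed.

Lemma tangent_is_vbundle : is_vbundle tangent_pre.
Proof.
split.
- by move=> _ [c _ <-]; exact: cdom_open.
- move=> p; have [ap cp] := chart_atP p.
  by exists (tangent_triv (chart_at p)) => //; exists (chart_at p).
- move=> _ [c ac <-] p cp v; have [ap pp] := chart_atP p.
  exact: etrans (trans_diff v ap ac ap pp cp pp) (trans_diff_id v pp).
- move=> _ [c ac <-] p cp v; have [ap pp] := chart_atP p.
  exact: etrans (trans_diff v ac ap ac cp pp cp) (trans_diff_id v cp).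
move=> _ _ [c ac <-] [d ad <-] b ab k /=.
have oA := cdomI_open (c := b) (openI (cdom_open c) (cdom_open d)).
apply: Ck_on_mx => // i j.
apply: (@Ck_on_ext _ _ _ k _ (fun x =>
  (((fun y => 'd (cmap d \o cinv c) y (delta_mx 0 i)) \o (cmap c \o cinv b)) x)
    0 j)) => //.
  move=> x [p [bp [cp dp]] px]; have e : cinv b x = p by rewrite -px cmapK.
  have key := tangent_transition i j ac ad cp dp; rewrite -e in key.
  exact: esym key.
apply: Ck_on_coord => //.
apply: (Ck_on_comp (B := cmap c @` (cdom c `&` cdom d))) => //.
- by move=> _ [p [bp [cp dp]] <-] /=; rewrite cmapK //; exists p.
- apply: Ck_on_sub (atlas_compat ab ac k) => _ [p [bp [cp dp]] <-].
  by exists p.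
- by have [_] := atlas_compat ac ad k.+1; exact.
Qed.

Definition tangent_bundle : vbundle M n := VBundle tangent_is_vbundle.

Definition riemannian_metric := fibre_metric tangent_bundle.

Definition chart_metric (h : riemannian_metric) (c : chart R M n)
    (x : 'rV[R]_n) : 'M[R]_n :=
  @gram _ M n tangent_bundle h (tangent_triv c) (cinv c x).

End Tangent.

Definition mdiff (m n : nat) (M : manifold R m) (N : manifold R n) (f : M -> N)
    (p : M) : {linear tangent_bundle M p -> tangent_bundle N (f p)} :=
  'd (cmap (chart_at (f p)) \o f \o cinv (chart_at p)) (cmap (chart_at p) p).

Definition smooth_embedding_on (m n : nat) (M : manifold R m)
    (N : manifold R n) (U : set M) (f : M -> N) : Prop :=
  [/\ smooth_map_on U f,
      forall p, U p -> injective (mdiff f p) &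
      exists2 g : N -> M, forall p, U p -> g (f p) = p
                        & {within f @` U, continuous g}].

Section Einstein.
Context {n : nat}.

Definition partial (i : 'I_n) (f : 'rV[R]_n -> R) (x : 'rV[R]_n) : R :=
  'D_(delta_mx 0 i) f x.

Definition christoffel (G : 'rV[R]_n -> 'M[R]_n) (k i j : 'I_n)
    (x : 'rV[R]_n) : R :=
  2^-1 * \sum_l invmx (G x) k l *
    (partial i (fun y => G y j l) x + partial j (fun y => G y i l) x
     - partial l (fun y => G y i j) x).

(* The sign is such that round spheres have positive Ricci curvature. *)
Definition ricci (G : 'rV[R]_n -> 'M[R]_n) (i j : 'I_n) (x : 'rV[R]_n) : R :=
  \sum_k (partial k (christoffel G k i j) x - partial j (christoffel G k i k) x
    + \sum_l (christoffel G k k l x * christoffel G l i j x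
              - christoffel G k j l x * christoffel G l i k x)).

Definition einstein (M : manifold R n) (h : riemannian_metric M) : Prop :=
  exists lambda : R, forall c : chart R M n, atlas c ->
    forall p, cdom c p -> forall i j,
    ricci (chart_metric h c) i j (cmap c p)
      = lambda * chart_metric h c (cmap c p) i j.

End Einstein.

(* [normalized] is the normalization convention imposed on the Einstein metrics
   (unit volume, prescribed Einstein constant, ...); it is left arbitrary. *)
Record einstein_family (d n : nat) (S : manifold R d) (M : manifold R n)
    (normalized : set (riemannian_metric M)) := EinsteinFamily {
  family_fun :> S -> riemannian_metric M;
  family_einstein : forall p, einstein (family_fun p);
  family_normalized : forall p, normalized (family_fun p);
  family_smooth : forall (c : chart R S d) (e : chart R M n),
    atlas c -> atlas e ->
    Cinf_on ((cmap c @` cdom c) `*` (cmap e @` cdom e))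
      (fun z : 'rV[R]_d * 'rV[R]_n =>
         chart_metric (family_fun (cinv c z.1)) e z.2) }.

Definition response_metric (d k : nat) (S : manifold R d) (Z : vbundle S k)
    (hZ : fibre_metric Z) (A : bundle_hom_on setT (tangent_bundle S) Z)
    (p : S) (X Y : tangent_bundle S p) : R :=
  hZ p (A p X) (A p Y).

End Manifolds.

(* Main.v *)
(* The response form being definite at [p] makes [Rm p] injective, hence also
   [d Theta_p = Psi_p o Rm_p]; so the theorem reduces to the fact that a map with
   injective derivative at a point is an embedding near it.  No inverse function
   theorem is needed: if [B] is a left inverse of the derivative of the chart
   expression [F] at the point, the mean value theorem applied to [B o F - id]
   gives [|x - y| <= 2 |B (F x) - B (F y)|] near the point, which yields
   injectivity and the continuity of the inverse at once, and the injectivity of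
   the derivative persists nearby. *)
From HB Require Import structures.
Require Import Defs.
From mathcomp Require Import all_boot all_order all_algebra.
From mathcomp Require Import all_classical all_reals all_analysis.
From mathcomp Require Import lra.
Set Implicit Arguments.
Unset Strict Implicit.
Unset Printing Implicit Defensive.
Import Order.TTheory GRing.Theory Num.Theory.
Import numFieldNormedType.Exports.
Local Open Scope classical_set_scope.
Local Open Scope ring_scope.

(** * Continuity and derivatives of linear operations on matrix-valued maps *)

Lemma mulmxr_continuous (R : realType) (m n : nat) (B : 'M[R]_(m, n)) :
  continuous (mulmxr B : 'rV[R]_m -> 'rV[R]_n).
Proof.
move=> x; have oT : open [set: 'rV[R]_m] by exact: openT.
(* Continuity is [Ck_on 0], so the entrywise closure of [Ck_on] under sums and products applies. *)
suff: Ck_on 0 setT (mulmxr B : 'rV[R]_m -> 'rV[R]_n) by exact.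
apply: Ck_on_mx => // i j.
apply: (@Ck_on_ext _ _ _ 0 _ (fun v : 'rV[R]_m =>
  \sum_(l <- enum 'I_m) v i l * B l j)) => //.
  by move=> v _; rewrite /= mxE big_enum.
apply: Ck_on_sum => // l; apply: Ck_onM => //; last exact: Ck_on_cst.
by apply: Ck_on_coord => // v _; exact: cvg_id.
Qed.

Lemma diff_mulmxr (R : realType) (V : normedModType R) (m n : nat)
    (f : V -> 'rV[R]_m) (B : 'M[R]_(m, n)) (x : V) : differentiable f x ->
  differentiable (fun y => f y *m B) x /\
  forall v, 'd (fun y => f y *m B) x v = 'd f x v *m B.
Proof.
move=> df.
have dB : differentiable (mulmxr B : 'rV[R]_m -> 'rV[R]_n) (f x).
  exact/linear_differentiable/mulmxr_continuous.
split=> [|v]; first exact: (differentiable_comp df dB).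
rewrite -[fun y => _]/((mulmxr B : 'rV[R]_m -> 'rV[R]_n) \o f).
by rewrite (diff_comp df dB) /= diff_lin //; exact: mulmxr_continuous.
Qed.

Lemma diff_coord (R : realType) (V : normedModType R) (m n : nat)
    (f : V -> 'M[R]_(m, n)) (i : 'I_m) (j : 'I_n) (x : V) :
  differentiable f x -> differentiable (fun y => f y i j) x /\
  forall v, 'd (fun y => f y i j) x v = 'd f x v i j.
Proof.
move=> df; pose c (N : 'M[R]_(m, n)) : R := N i j.
have lc : linear c by move=> a u v; rewrite /c !mxE.
pose cM := GRing.isLinear.Build _ _ _ _ _ lc.
pose cL : {linear 'M[R]_(m, n) -> R} := HB.pack c cM.
have cc : continuous cL by exact: coord_continuous.
have dL : differentiable cL (f x) by exact: linear_differentiable.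
split=> [|v]; first exact: (differentiable_comp df dL).
rewrite -[fun y => _]/(cL \o f) (diff_comp df dL).
exact: (congr1 (fun h => h ('d f x v)) (diff_lin (f x) cc)).
Qed.

(** * Sup-norm estimates, the mean value theorem and expansion near an immersed point *)

Lemma coord_le_norm (R : realType) (m n : nat) (x : 'M[R]_(m, n)) i j :
  `|x i j| <= `|x|.
Proof.
rewrite [leRHS]/Num.Def.normr /= mx_normrE; apply/bigmax_geP; right.
by exists (i, j).
Qed.

Lemma norm_le_coord (R : realType) (m n : nat) (x : 'M[R]_(m, n)) (c : R) :
  0 <= c -> (forall i j, `|x i j| <= c) -> `|x| <= c.
Proof.
move=> c0 xc; rewrite [leLHS]/Num.Def.normr /= mx_normrE.
by apply/bigmax_leP; split.
Qed.

(** Vector-valued maps have no common intermediate point, so the scalar theorem is applied to one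
    coordinate along the segment; [t] depends on [i]. This suffices because the norm is the maximum
    over coordinates. *)
Lemma rV_mean_value (R : realType) (V : normedModType R) (n : nat)
    (f : V -> 'rV[R]_n) (x y : V) (i : 'I_n) :
  (forall t : R, t \in `[0, 1] -> differentiable f (y + t *: (x - y))) ->
  exists2 t, t \in `[0, 1] &
    (f x - f y) 0 i = 'd f (y + t *: (x - y)) (x - y) 0 i.
Proof.
move=> df; pose g (t : R) : V := y + t *: (x - y).
have dg (t : R) : is_diff t g (fun s => s *: (x - y)).
  by rewrite /g; apply: is_diff_eq; rewrite /= add0r.
have dp (t : R) : t \in `[0, 1] -> differentiable (fun s => f (g s) 0 i) t /\
    'd (fun s => f (g s) 0 i) t 1 = 'd f (g t) (x - y) 0 i.
  move=> t01; have dgt : differentiable g t by exact: ex_diff.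
  have dfg : differentiable (f \o g) t.
    exact: (differentiable_comp dgt (df t t01)).
  have [dc cE] := @diff_coord _ _ _ _ _ 0 i _ dfg; split=> //.
  by rewrite cE (diff_comp dgt (df t t01)) /= diff_val scale1r.
have cp : {within `[0, 1], continuous (fun s => f (g s) 0 i)}.
  apply: continuous_in_subspaceT => t; rewrite inE => t01.
  by apply: differentiable_continuous; have [] := dp t t01.
have [] := @MVT_segment R (fun s => f (g s) 0 i)
  (fun t => 'd f (g t) (x - y) 0 i) 0 1 ler01 _ cp.
  move=> t t01; have [|dt tE] := dp t.
    by move: t01; rewrite !in_itv /= => /andP[/ltW-> /ltW->].
  by split; [exact/derivable1_diffP|rewrite deriveE].
move=> t t01 E; exists t => //.
rewrite -[RHS]mulr1 -[X in _ * X](subr0 1) -E /g scale1r scale0r addr0 subrKC.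
by rewrite !mxE.
Qed.

Lemma ball_segment (R : realType) (V : normedModType R) (x0 x y : V)
    (r t : R) :
  ball x0 r x -> ball x0 r y -> t \in `[0, 1] -> ball x0 r (y + t *: (x - y)).
Proof.
rewrite -ball_normE /= in_itv /= => xr yr /andP[t0 t1].
have -> : x0 - (y + t *: (x - y)) = (1 - t) *: (x0 - y) + t *: (x0 - x).
  have -> : t *: (x - y) = t *: (x0 - y) - t *: (x0 - x).
    by rewrite -scalerBr opprB [x0 - y + _]addrC addrA subrK.
  by rewrite scalerBl scale1r opprD opprB addrA [_ - t *: _]addrC addrA.
apply: le_lt_trans (ler_normD _ _) _; rewrite !normrZ.
rewrite (ger0_norm t0) ger0_norm; last by rewrite subr_ge0.
(* The strict inequality is to come from the term of weight [t], so [t = 0] is treated apart. *)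
have [->|tn0] := eqVneq t 0; first by rewrite subr0 mul1r mul0r addr0.
have tb : t * `|x0 - x| < t * r by rewrite ltr_pM2l // lt_neqAle eq_sym tn0.
have ta : (1 - t) * `|x0 - y| <= (1 - t) * r.
  by rewrite ler_wpM2l ?subr_ge0 // ltW.
lra.
Qed.

(** [Ck_on 1] only gives continuity of the derivative on each fixed vector. Applying it to the
    finitely many basis vectors and expanding [v] in them yields a bound uniform in [v]. *)
Lemma diff_near_id (R : realType) (n : nat) (A : set 'rV[R]_n)
    (h : 'rV[R]_n -> 'rV[R]_n) (x0 : 'rV[R]_n) :
  open A -> A x0 -> Ck_on 1 A h -> (forall v, 'd h x0 v = v) ->
  \forall x \near x0, forall v, `|'d h x v - v| <= 2^-1 * `|v|.
Proof.
move=> oA Ax0 [_ Ch] h0.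
(* The [n] basis vectors contribute at most [n * d <= 1/2] in total; [n.+1] keeps [d] positive when
   [n = 0]. *)
pose d : R := (2 * n.+1%:R)^-1.
have d0 : 0 < d by rewrite invr_gt0 mulr_gt0 ?ltr0n.
have dist_sub (a b c : 'rV[R]_n) : a = c -> `|a - b| < d -> `|b - c| < d.
  by move=> ->; rewrite distrC.
have H : \forall x \near x0, forall i : 'I_n,
    `|'d h x (delta_mx 0 i) - delta_mx 0 i| < d.
  apply: (@filter_forall _ _ (fun (i : 'I_n) x =>
    `|'d h x (delta_mx 0 i) - delta_mx 0 i| < d) (nbhs x0) _) => i.
  have /cvgrPdist_lt/(_ d d0) := Ch (delta_mx 0 i) x0 Ax0.
  apply: filterS => x; exact: dist_sub (h0 _).
apply: filterS H => x Hx v.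
have -> : 'd h x v - v = \sum_i v 0 i *: ('d h x (delta_mx 0 i) - delta_mx 0 i).
  rewrite [X in 'd h x X - X]row_sum_delta linear_sum /= -sumrB.
  by apply: eq_bigr => i _; rewrite linearZ scalerBr.
apply: le_trans (ler_norm_sum _ _ _) _.
apply: (@le_trans _ _ (\sum_(i < n) `|v| * d)).
  apply: ler_sum => i _; rewrite normrZ ler_pM //; last exact: ltW.
  exact: coord_le_norm.
rewrite sumr_const card_ord -[leLHS]mulr_natr -mulrA mulrC ler_wpM2r //.
rewrite /d invfM -mulrA ler_piMr // mulrC ler_pdivrMr ?ltr0n // mul1r.
by rewrite ler_nat.
Qed.

(** A single radius serves both conclusions: on the ball the derivative of [h = F *m B] is within
    [1/2] of the identity. This gives the expansion by integration along segments, and a vector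
    killed by ['d F x] satisfies [|v| <= |v| / 2]. *)
Lemma immersion_expanding (R : realType) (m n : nat) (A : set 'rV[R]_m)
    (F : 'rV[R]_m -> 'rV[R]_n) (x0 : 'rV[R]_m) :
  open A -> A x0 -> Ck_on 1 A F -> (forall v, 'd F x0 v = 0 -> v = 0) ->
  exists (B : 'M[R]_(n, m)) (r : R), [/\ 0 < r,
    forall x y, ball x0 r x -> ball x0 r y ->
      `|x - y| <= 2 * `|F x *m B - F y *m B| &
    forall x, ball x0 r x -> forall v, 'd F x v = 0 -> v = 0].
Proof.
move=> oA Ax0 CF inj; have [dF _] := CF.
pose J : 'M[R]_(m, n) := lin1_mx ('d F x0).
(* Vectors are rows and [J] acts on the right, so injectivity of the derivative is a trivial left
   kernel, and [J *m B = 1] makes multiplication by [B] undo it. *)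
have freeJ : row_free J.
  rewrite -kermx_eq0; apply/eqP/row_matrixP => i; rewrite row0.
  by apply: inj; rewrite -mul_rV_lin1 -row_mul mulmx_ker row0.
pose B := pinvmx J; pose h x := F x *m B.
have dh x : A x -> differentiable h x /\ forall v, 'd h x v = 'd F x v *m B.
  by move=> /dF; exact: diff_mulmxr.
have Ch : Ck_on 1 A h.
  have cB : continuous (mulmxr B : {linear 'rV[R]_n -> 'rV[R]_m}).
    exact: mulmxr_continuous.
  by apply: Ck_on_ext (Ck_on_linear oA cB CF).
have h0 v : 'd h x0 v = v.
  have [_ ->] := dh x0 Ax0.
  by rewrite -mul_rV_lin1 -/J -mulmxA mulmxVp // mulmx1.
have nA : nbhs x0 A by exact: open_nbhs_nbhs.
have nh := diff_near_id oA Ax0 Ch h0.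
have : nbhs x0 (A `&` [set x | forall v, `|'d h x v - v| <= 2^-1 * `|v|]).
  exact: filterI nA nh.
move/nbhs_ballP => [r /= r0 rP].
exists B, r; split.
- exact: r0.
- move=> x y xr yr.
  have key : `|(h x - h y) - (x - y)| <= 2^-1 * `|x - y|.
    apply: norm_le_coord => [|j i]; first by rewrite mulr_ge0 // invr_ge0.
    rewrite (ord1 j).
    have seg (t : R) : t \in `[0, 1] -> ball x0 r (y + t *: (x - y)).
      exact: ball_segment.
    have [t t01 E] := @rV_mean_value R _ _ h x y i (fun t t01 =>
      (dh _ (rP _ (seg t t01)).1).1).
    have [_ /(_ (x - y))] := rP _ (seg t t01).
    apply: le_trans; apply: le_trans (coord_le_norm _ 0 i).
    by rewrite !mxE in E *; rewrite E.
  (* Write [x - y] as [h x - h y] minus the error bounded in [key], and absorb the half into the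
     left side. *)
  have := ler_normB (h x - h y) (h x - h y - (x - y)).
  rewrite subKr -/(h x) -/(h y).
  lra.
move=> x /rP[Ax hx] v Fv.
have := hx v; have [_ dhE] := dh x Ax.
rewrite dhE Fv mul0mx sub0r normrN => le2.
by apply/eqP; rewrite -normr_le0; lra.
Qed.

(** * Derivatives of a map read in different charts *)

Lemma open_setI_preimage (S T : topologicalType) (U : set S) (O : set T)
    (f : S -> T) : open U -> open O ->
  (forall p, U p -> {for p, continuous f}) -> open (U `&` f @^-1` O).
Proof.
move=> oU oO cf; rewrite openE => p [Up Op]; apply: filterI.
  exact: open_nbhs_nbhs.
by apply: (cf p Up); exact: open_nbhs_nbhs.
Qed.

Section ChartChange.
Context (R : realType) (m n : nat) (M : manifold R m) (N : manifold R n).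
Context (U : set M) (f : M -> N).
Context (oU : open U) (sf : smooth_map_on U f).
Implicit Types (c : chart R M m) (e : chart R N n).

Lemma chart_expr_open c e :
  open (cmap c @` (cdom c `&` U `&` f @^-1` cdom e)).
Proof.
have [cf _] := sf; rewrite -setIA; apply: cdomI_open.
exact: open_setI_preimage (cdom_open e) cf.
Qed.

Lemma chart_expr_near c e (P : set 'rV[R]_m) q :
  cdom c q -> U q -> cdom e (f q) ->
  (forall q', cdom c q' -> cdom e (f q') -> P (cmap c q')) ->
  nbhs (cmap c q) P.
Proof.
move=> cq Uq eq HP.
have : nbhs (cmap c q) (cmap c @` (cdom c `&` U `&` f @^-1` cdom e)).
  by apply: open_nbhs_nbhs; split; [exact: chart_expr_open|exists q].
by apply: filterS => _ [q' [[cq' _] eq'] <-]; exact: HP.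
Qed.

Lemma chart_expr_differentiable c e q : atlas c -> atlas e ->
  cdom c q -> U q -> cdom e (f q) ->
  differentiable (cmap e \o f \o cinv c) (cmap c q).
Proof.
move=> ac ae cq Uq eq; have [_ /(_ c e ac ae 1)] := sf.
by case=> + _; apply; exists q.
Qed.

(** Chain rule. The composite agrees with the direct chart expression only near the point, where
    [cinv] really inverts [cmap], hence the use of [near_eq_diff]. *)
Lemma chart_expr_source c d e q v : atlas c -> atlas d -> atlas e ->
  cdom c q -> cdom d q -> U q -> cdom e (f q) ->
  'd (cmap e \o f \o cinv d) (cmap d q) ('d (cmap d \o cinv c) (cmap c q) v) =
  'd (cmap e \o f \o cinv c) (cmap c q) v.
Proof.
move=> ac ad ae cq dq Uq eq.
have dcd := trans_differentiable ac ad cq dq.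
have dd := chart_expr_differentiable ad ae dq Uq eq.
have fx : (cmap d \o cinv c) (cmap c q) = cmap d q by rewrite /= cmapK.
have dd' : differentiable (cmap e \o f \o cinv d)
    ((cmap d \o cinv c) (cmap c q)).
  by rewrite fx.
have nE : \forall x \near cmap c q,
    ((cmap e \o f \o cinv d) \o (cmap d \o cinv c)) x =
    (cmap e \o f \o cinv c) x.
  have o := cdomI_open (c := c) (cdom_open d).
  have : nbhs (cmap c q) (cmap c @` (cdom c `&` cdom d)).
    by apply: open_nbhs_nbhs; split => //; exists q.
  by apply: filterS => _ [q' [cq' dq'] <-] /=; rewrite cmapK // cmapK.
have [_ E] := near_eq_diff nE (differentiable_comp dcd dd').
exact: esym (etrans (E v) (diff_compE v fx dcd dd)).
Qed.

Lemma chart_expr_target c d e q v : atlas c -> atlas d -> atlas e ->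
  cdom c q -> U q -> cdom d (f q) -> cdom e (f q) ->
  'd (cmap e \o cinv d) (cmap d (f q))
    ('d (cmap d \o f \o cinv c) (cmap c q) v) =
  'd (cmap e \o f \o cinv c) (cmap c q) v.
Proof.
move=> ac ad ae cq Uq dq eq.
have dde := trans_differentiable ad ae dq eq.
have dd := chart_expr_differentiable ac ad cq Uq dq.
have fx : (cmap d \o f \o cinv c) (cmap c q) = cmap d (f q) by rewrite /= cmapK.
have dde' : differentiable (cmap e \o cinv d)
    ((cmap d \o f \o cinv c) (cmap c q)).
  by rewrite fx.
have nE : \forall x \near cmap c q,
    ((cmap e \o cinv d) \o (cmap d \o f \o cinv c)) x =
    (cmap e \o f \o cinv c) x.
  apply: (chart_expr_near cq Uq dq) => q' cq' dq' /=.
  by rewrite !cmapK.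
have [_ E] := near_eq_diff nE (differentiable_comp dd dde').
exact: esym (etrans (E v) (diff_compE v fx dd dde)).
Qed.

(** [mdiff] uses the charts chosen at [q] and at [f q], which may jump as [q] moves. This transfers
    injectivity from one fixed pair of charts to every nearby [q]: the [c]-coordinates of [X]
    vanish, and so does [X], since transition derivatives are invertible. *)
Lemma mdiff_eq0 c e q X : atlas c -> atlas e ->
  cdom c q -> U q -> cdom e (f q) ->
  (forall v, 'd (cmap e \o f \o cinv c) (cmap c q) v = 0 -> v = 0) ->
  mdiff f q X = 0 -> X = 0.
Proof.
move=> ac ae cq Uq eq inj X0.
have [aq qq] := chart_atP q; have [af ff] := chart_atP (f q).
have H := chart_expr_target X aq af ae qq Uq ff eq.
have H' := chart_expr_source X aq ac ae qq cq Uq eq.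
have E : 'd (cmap c \o cinv (chart_at q)) (cmap (chart_at q) q) X = 0.
  apply: inj; apply: (etrans H'); apply: (etrans (esym H)).
  by apply: (etrans (congr1 _ X0)); rewrite linear0.
have T := trans_diff X aq ac aq qq cq qq.
have I := trans_diff_id X qq.
apply: (etrans (esym I)); apply: (etrans (esym T)).
exact: (etrans (congr1 _ E) (linear0 _)).
Qed.

End ChartChange.

(** * From an injective differential to a local embedding *)

Lemma immersion_local_embedding (R : realType) (m n : nat) (M : manifold R m)
    (N : manifold R n) (U : set M) (f : M -> N) (p : M) :
  open U -> smooth_map_on U f -> U p -> (forall X, mdiff f p X = 0 -> X = 0) ->
  exists U0 : set M, [/\ open U0, U0 p, U0 `<=` U & smooth_embedding_on U0 f].
Proof.
move=> oU sf Up inj; have [cf smf] := sf.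
have [] := chart_atP p; have [] := chart_atP (f p).
move: inj; rewrite /mdiff.
(* The charts chosen at [p] are now fixed and used at all points of [U0]. *)
move: (chart_at p) (chart_at (f p)) => c e inj ae ep ac cp.
set A := cmap c @` (cdom c `&` U `&` f @^-1` cdom e).
have oA : open A by exact: chart_expr_open.
have Ap : A (cmap c p) by exists p.
have [B [r [r0 expand injd]]] :=
  immersion_expanding oA Ap (smf c e ac ae 1) inj.
pose U0 := cdom c `&` U `&` f @^-1` cdom e `&` cmap c @^-1` ball (cmap c p) r.
have U0P q : U0 q ->
    [/\ cdom c q, U q, cdom e (f q) & ball (cmap c p) r (cmap c q)].
  by case=> [[[]]].
pose k (y : N) := cmap e y *m B.
have expandf q1 q2 : U0 q1 -> U0 q2 ->
    `|cmap c q1 - cmap c q2| <= 2 * `|k (f q1) - k (f q2)|.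
  move=> /U0P[c1 _ _ b1] /U0P[c2 _ _ b2]; have := expand _ _ b1 b2.
  by rewrite /= !cmapK.
have injf q1 q2 : U0 q1 -> U0 q2 -> f q1 = f q2 -> q1 = q2.
  move=> u1 u2 f12; have := expandf _ _ u1 u2.
  rewrite f12 subrr normr0 mulr0 normr_le0 subr_eq0 => /eqP c12.
  have [[c1 _ _ _] [c2 _ _ _]] := (U0P _ u1, U0P _ u2).
  by rewrite -(cmapK c1) c12 cmapK.
exists U0; split.
- apply: open_setI_preimage; last by move=> q [[cq _] _]; exact: cmap_cont.
    apply: open_setI_preimage (cdom_open e) _.
      by apply: openI oU; exact: cdom_open.
    by move=> q [_ /cf].
  exact: ball_open.
- by split; [split|exact: ballxx].
- by move=> q /U0P[].
split.
- split=> [q /U0P[_ Uq _ _]|d d' ad ad' j]; first exact: cf.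
  apply: Ck_on_sub (smf d d' ad ad' j); apply: image_subset.
  by apply: setSI; apply: setIS => q /U0P[].
- move=> q /U0P[cq Uq eq bq] X Y XY; apply/eqP; rewrite -subr_eq0; apply/eqP.
  apply: (mdiff_eq0 oU sf ac ae cq Uq eq (injd _ bq)).
  by rewrite linearB XY subrr.
(* The default [p] is the value off the image of [U0], where no continuity is required. *)
pose g (y : N) := xget p [set q | U0 q /\ f q = y].
have gf q : U0 q -> g (f q) = q.
  move=> U0q; rewrite /g; case: xgetP => [q' _ [U0q' f']|/(_ q)[]//].
  exact: injf.
exists g => //; apply/subspace_continuousP => _ [q U0q <-].
have [cq Uq eq bq] := U0P q U0q.
rewrite /from_subspace (gf q U0q) => V qV.
have /nbhs_ballP[d /= d0 dV] : nbhs (cmap c q) (cinv c @^-1` V).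
  by apply: (cinv_cont cq); rewrite cmapK.
have kc : {for f q, continuous k}.
  apply: (@continuous_comp _ _ _ (cmap e) (mulmxr B)); first exact: cmap_cont.
  exact: mulmxr_continuous.
(* Half of [d] compensates the factor 2 in [expandf], so closeness of [k] values within [d / 2]
   forces the chart coordinates to be within [d]. *)
have /cvgrPdist_lt/(_ (d / 2)) := kc.
rewrite divr_gt0 // => /(_ isT) knear.
apply: filterS knear => y /= ky [q' U0q' q'y]; rewrite -q'y (gf q' U0q').
have [cq' _ _ _] := U0P q' U0q'.
rewrite -(cmapK cq'); apply: dV; rewrite -ball_normE /=.
have := expandf _ _ U0q U0q'; rewrite q'y.
lra.
Qed.

Theorem theorem3p5 (R : realType) (dS dM dN k : nat)
    (S : manifold R dS) (M : manifold R dM)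
    (normalized : set (riemannian_metric M))
    (g : einstein_family S normalized)
    (Z : vbundle S k) (hZ : fibre_metric Z)
    (Rm : bundle_hom_on setT (tangent_bundle S) Z)
    (U : set S) (hU : open U)
    (N : manifold R dN) (hN : riemannian_metric N)
    (Theta : S -> N) (hTheta : smooth_map_on U Theta)
    (Psi : bundle_hom_on U Z (pullback Theta (tangent_bundle N)))
    (hPsi : bundle_iso_on Psi)
    (hPsiR : forall q, U q -> forall X : tangent_bundle S q,
       Psi q (Rm q X) = mdiff Theta q X)
    (p : S) (hp : U p) (hpos : posdef (response_metric hZ Rm (p := p))) :
  exists U0 : set S,
    [/\ open U0, U0 p, U0 `<=` U, smooth_embedding_on U0 Theta &
        forall q1 q2, U0 q1 -> U0 q2 -> Theta q1 = Theta q2 -> q1 = q2].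
Proof.
have inj X : mdiff Theta p X = 0 -> X = 0.
  move=> X0; have [Psi' /(_ p hp)[PsiK _]] := hPsi.
  (* Injectivity of [Psi p] turns [Psi p (Rm p X) = 0] into [Rm p X = 0]. *)
  have RX0 : Rm p X = 0 by rewrite -(PsiK (Rm p X)) hPsiR // X0 linear0.
  apply/eqP; apply: contraT => /hpos; rewrite /response_metric RX0.
  (* Linearity with scalar [-1] at zero vectors gives [hZ p 0 0 = 0], contradicting positivity at a
     nonzero [X]. *)
  have := metric_lin hZ (-1) (0 : Z p) 0 0.
  by rewrite scaleN1r oppr0 addr0 mulN1r addNr => ->; rewrite ltxx.
have [U0 [oU0 U0p U0U emb]] := immersion_local_embedding hU hTheta hp inj.
exists U0; split=> // q1 q2 U1 U2 e12.
by have [_ _ [h hK _]] := emb; rewrite -(hK _ U1) e12 hK.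
Qed.
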